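(* Assume $N:=-\lambda_1-\alpha_1\in\mathbb{Z}_{\ge0}$, $\beta<1$, $\alpha_2-\alpha_1<1$, $t_1>0$, $t_2>0$, $h_1<h_2$, $l_1<l_2$, and moreover $1+h_2-l_2-\beta>0$ and $2+2h_2-l_1-l_2-\beta>0$. Let $c_{N+1}(E)$ be the polynomial in $E$ (depending on $q\in(0,1)$) defined in the context. (i) The polynomial $c_{N+1}(E)$ satisfies, as $q\to+0$, $$c_{N+1}(E)\sim (t_1t_2)^{-N-1}q^{(N/2+\lambda_1-h_1-h_2)(N+1)}\prod_{k=1}^{N+1}\left(E+q^{3/2-k+h_1-\lambda_1}t_1\right).$$ (ii) There exist solutions $E_k(q)$ $(k=1,2,\dots,N+1)$ to the equation $c_{N+1}(E)=0$ for sufficiently small $q>0$ such that $$E_k(q)\sim -q^{-k+3/2+h_1-\lambda_1}\,t_1 .$$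
   Context: The parameters $t_1,t_2,h_1,h_2,l_1,l_2,\alpha_1,\alpha_2,\beta$ are fixed real numbers independent of $q$, and $0<q<1$ is a variable. Set $\lambda_1=(h_1+h_2-l_1-l_2-\alpha_1-\alpha_2-\beta+2)/2$. For functions of $q$: $a(q)\sim b(q)$ means $\lim_{q\to+0}a(q)/b(q)=1$. For polynomials with $q$-dependent coefficients, $\sum_{j=0}^M a_j(q)E^j\sim\sum_{j=0}^M b_j(q)E^j$ means $a_j(q)\sim b_j(q)$ for all $j=0,\dots,M$. The polynomials $c_n(E)$ are defined by $c_{-1}(E)=0$, $c_0(E)=1$ and, for $n=1,\dots,N+1$, $$c_n(E)\,t_1t_2q^{h_1+h_2}(1-q^n)(1-q^{n-\beta})=c_{n-1}(E)\Big[Eq^{n-1+\lambda_1}+q^{1/2}(q^{h_1}t_1+q^{h_2}t_2)+(q^{l_1}t_1+q^{l_2}t_2)q^{2(n-1+\lambda_1)+\alpha_1+\alpha_2-1/2}\Big]$$ $$-c_{n-2}(E)\,q\,(1-q^{n-2+\lambda_1+\alpha_1})(1-q^{n-2+\lambda_1+\alpha_2}).$$ *)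

(* Defs.v *)
From HB Require Import structures.
From mathcomp Require Import all_boot all_order all_algebra.
From mathcomp Require Import all_classical all_reals all_analysis.

Set Implicit Arguments.
Unset Strict Implicit.
Unset Printing Implicit Defensive.

Import Order.TTheory GRing.Theory Num.Theory.
Import numFieldNormedType.Exports.

Local Open Scope classical_set_scope.
Local Open Scope ring_scope.

(* Since x / 0 = 0, the limit being 1 forces b to be nonzero near 0+. *)
Definition asymp (R : realType) (a b : R -> R) : Prop :=
  (fun q : R => a q / b q) @ 0^'+ --> (1 : R).

(* The size bounds say that the terms of degree at most M are all of a and b. *)
Definition poly_asymp (R : realType) (M : nat) (a b : R -> {poly R}) : Prop :=
  (forall q : R, 0 < q < 1 -> (size (a q) <= M.+1)%N /\ (size (b q) <= M.+1)%N)
  /\ (forall j : nat, (j <= M)%N ->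
        asymp (fun q => (a q)`_j) (fun q => (b q)`_j)).

Definition lambda1 (R : realType) (h1 h2 l1 l2 alpha1 alpha2 beta : R) : R :=
  (h1 + h2 - l1 - l2 - alpha1 - alpha2 - beta + 2) / 2.

Section Recurrence.
Variables (R : realType) (t1 t2 h1 h2 l1 l2 alpha1 alpha2 beta q : R).
Local Notation lam := (lambda1 h1 h2 l1 l2 alpha1 alpha2 beta).

Definition c_lead (n : nat) : R :=
  t1 * t2 * q `^ (h1 + h2) * (1 - q ^+ n) * (1 - q `^ (n%:R - beta)).

Definition c_bracket (n : nat) : {poly R} :=
  q `^ (n%:R - 1 + lam) *: 'X
  + (q `^ (1 / 2) * (q `^ h1 * t1 + q `^ h2 * t2)
     + (q `^ l1 * t1 + q `^ l2 * t2)
       * q `^ (2 * (n%:R - 1 + lam) + alpha1 + alpha2 - 1 / 2))%:P.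

Definition c_trail (n : nat) : R :=
  q * (1 - q `^ (n%:R - 2 + lam + alpha1))
    * (1 - q `^ (n%:R - 2 + lam + alpha2)).

(* The recurrence solved for its highest term; the inner match yields
   c_{n-2}, with c_{-1} = 0. *)
Fixpoint c_poly (n : nat) : {poly R} :=
  if n is m.+1 then
    (c_lead n)^-1 *:
      (c_poly m * c_bracket n - c_trail n *: (if m is p.+1 then c_poly p else 0))
  else 1.

Lemma c_lead_neq0 (n : nat) : 0 < t1 -> 0 < t2 -> beta < 1 -> 0 < q < 1 ->
  (0 < n)%N -> c_lead n != 0.
Proof.
move=> t1_gt0 t2_gt0 beta_lt1 /andP[q_gt0 q_lt1] n_gt0.
have nb : 0 < n%:R - beta.
  by rewrite subr_gt0 (lt_le_trans beta_lt1)// ler1n.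
rewrite /c_lead !mulf_neq0 ?gt_eqF ?powR_gt0// subr_gt0.
  by rewrite exprn_ilt1 ?ltW// -lt0n.
have := @gt0_ltr_powR R _ nb q 1.
by rewrite powR1 !nnegrE; apply=> //; rewrite ltW.
Qed.

Lemma c_polyE (n : nat) : 0 < t1 -> 0 < t2 -> beta < 1 -> 0 < q < 1 ->
  (0 < n)%N ->
  c_lead n *: c_poly n =
    c_poly n.-1 * c_bracket n
    - c_trail n *: (if n is p.+2 then c_poly p else 0).
Proof.
case: n => // n t1_gt0 t2_gt0 beta_lt1 q01 _.
by rewrite [c_poly n.+1]/= scalerA divff ?scale1r ?c_lead_neq0//; case: n.
Qed.

End Recurrence.

(* Main.v *)
Require Import Defs.
From HB Require Import structures.
From mathcomp Require Import all_boot all_order all_algebra.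
From mathcomp Require Import all_classical all_reals all_analysis.
From mathcomp Require Import ring lra.

(** Divided by [c_lead], the recurrence reads
    [c_n = c_(n-1) * M_n - T_n * c_(n-2)] with [M_n] of degree one in [E].  As
    q tends to 0+, each of the two coefficients of [M_n] is dominated by a
    single power of q, so that [M_n] is close to
    [B_n = s_n * (E + a_n)] with [s_n = q^(n-1+lam-h1-h2) / (t1 t2)] and
    [a_n = q^(3/2-n+h1-lam) t1].  In the constant coefficient the competing
    power of q is the one that [1 + h2 - l2 - beta > 0] makes negligible.
    Since [lam + alpha1 = -N], both powers of q in [c_trail] have a negative
    exponent for n <= N+1, hence they dominate the 1 from which they are
    subtracted; the resulting exponent of [T_n] exceeds that of the product of
    the constant coefficients of [B_n] and [B_(n-1)] by
    [2(n-2) + 2 + 2 h2 - l1 - l2 - beta > 0].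

    All coefficients of the [B_n] are nonnegative.  Nothing cancels in products
    of such polynomials, so closeness relative to each coefficient
    ([coef_close]) is stable under products, and a correction that is small
    against two consecutive constant coefficients is small against every
    coefficient of the product.  Induction on the recurrence
    ([coef_close_recurrence], [c_poly_close]) gives
    [c_(N+1) ~ B_1 ... B_(N+1)], which is the first claim.

    For the roots, the numbers [a_k] live on separate scales,
    [a_k = q * a_(k+1)].  Evaluated at a negative point [-x], the polynomial
    [c_(N+1)] differs from [P = B_1 ... B_(N+1)] by at most a small multiple
    of [P(x)] ([coef_close_horner]).  At [x = a_k (1 +- d)] every factor
    [a_j - x] is comparable to [a_j + x], hence [P(-x)] is comparable to
    [P(x)] and determines the sign of [c_(N+1)(-x)], while [P(-x)] changes sign
    between the two points ([root_near_scale]).  So there is a root within a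
    factor [1 +- d] of [-a_k], for every d > 0 and all q small enough in terms
    of d; [select_cvg] turns this into one function of q. *)

Set Implicit Arguments.
Unset Strict Implicit.
Unset Printing Implicit Defensive.

Import Order.TTheory GRing.Theory Num.Theory.
Import numFieldNormedType.Exports.

Local Open Scope classical_set_scope.
Local Open Scope ring_scope.

(** * Coefficientwise closeness to polynomials with nonnegative coefficients *)

(** The bound is relative to [p'`_j] and not to its absolute value: for
    [0 < e] it forces the coefficients of [p'] to be nonnegative, and it makes
    [p] vanish wherever [p'] does, which also settles the degrees. *)
Definition coef_close (R : realType) (e : R) (p p' : {poly R}) : Prop :=
  forall j, `|p`_j - p'`_j| <= e * p'`_j.

Section CoefClose.
Variable R : realType.
Implicit Types (p b : {poly R}) (e : R).

Lemma coef_close_ge0 e p p' j : 0 < e -> coef_close e p p' -> 0 <= p'`_j.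
Proof. by move=> e0 /(_ j) /(le_trans (normr_ge0 _)); rewrite pmulr_rge0. Qed.

Lemma coef_close_norm e p p' j : 0 < e -> coef_close e p p' ->
  `|p`_j| <= (1 + e) * p'`_j.
Proof.
move=> e0 cl; have p0 := coef_close_ge0 j e0 cl; have h := cl j.
have h3 := ler_distD p'`_j p`_j 0.
by rewrite !subr0 (ger0_norm p0) in h3; lra.
Qed.

(** Expand [p_i b_k - p'_i b'_k] along the two differences; because the
    coefficients of [p'] and [b'] are nonnegative, the sum of the three error
    terms over [i + k = j] is a multiple of the coefficient itself. *)
Lemma coef_closeM e d p p' b b' : 0 < e -> 0 < d ->
  coef_close e p p' -> coef_close d b b' ->
  coef_close (e + d + e * d) (p * b) (p' * b').
Proof.
move=> e0 d0 cp cb j; rewrite !coefM -sumrB mulr_sumr.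
apply: le_trans (ler_norm_sum _ _ _) _; apply: ler_sum => i _.
set k := (j - i)%N.
have hp := cp i; have hb := cb k.
have p0 := coef_close_ge0 i e0 cp; have b0 := coef_close_ge0 k d0 cb.
have -> : p`_i * b`_k - p'`_i * b'`_k =
  (p`_i - p'`_i) * (b`_k - b'`_k) + (p`_i - p'`_i) * b'`_k
  + p'`_i * (b`_k - b'`_k) by ring.
have -> : (e + d + e * d) * (p'`_i * b'`_k) =
  (e * p'`_i) * (d * b'`_k) + (e * p'`_i) * b'`_k + p'`_i * (d * b'`_k) by ring.
apply: le_trans (ler_normD _ _) _; apply: lerD; last first.
  by rewrite normrM (ger0_norm p0) ler_wpM2l.
apply: le_trans (ler_normD _ _) _; apply: lerD.
  by rewrite normrM ler_pM.
by rewrite normrM (ger0_norm b0) ler_wpM2r.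
Qed.

(** The left-hand side is one of the nonnegative terms of the convolution. *)
Lemma ler_coefM_coef0 p b j : (forall i, 0 <= p`_i) -> (forall i, 0 <= b`_i) ->
  p`_j * b`_0 <= (p * b)`_j.
Proof.
move=> p0 b0; rewrite coefM big_ord_recr /= subnn lerDr.
by apply: sumr_ge0 => i _; rewrite mulr_ge0.
Qed.

(** The j-th coefficient of the product of the [B i] for [i < n.+2] is at
    least [B_n(0) B_(n+1)(0)] times that of the product for [i < n]
    ([ler_coefM_coef0], twice), so the smallness of [T n] makes the last term
    negligible in every degree. *)
Lemma coef_close_recurrence (M B c : nat -> R -> {poly R}) (T : nat -> R -> R)
    (N : nat) :
  (forall q, c 0%N q = 1) -> (forall q, c 1%N q = M 0%N q) ->
  (forall n q, c n.+2 q = c n.+1 q * M n.+1 q - T n q *: c n q) ->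
  (forall n, (n <= N)%N -> forall e, 0 < e ->
     \forall q \near 0^'+, coef_close e (M n q) (B n q)) ->
  (forall n, (n < N)%N -> forall e, 0 < e ->
     \forall q \near 0^'+, `|T n q| <= e * ((B n q)`_0 * (B n.+1 q)`_0)) ->
  forall n, (n <= N.+1)%N -> forall e, 0 < e ->
     \forall q \near 0^'+, coef_close e (c n q) (\prod_(i < n) B i q).
Proof.
move=> c0 c1 cS closeM smallT.
have close1 e q : 0 < e -> coef_close e (1 : {poly R}) 1.
  by move=> e0 j; rewrite subrr normr0 coef1 mulr_ge0// ltW.
suff H n : ((n <= N.+1)%N -> forall e, 0 < e ->
     \forall q \near 0^'+, coef_close e (c n q) (\prod_(i < n) B i q)) /\
     ((n.+1 <= N.+1)%N -> forall e, 0 < e ->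
     \forall q \near 0^'+, coef_close e (c n.+1 q) (\prod_(i < n.+1) B i q)).
  by move=> n; case: (H n).
elim: n => [|n [IH0 IH1]]; split=> //.
- move=> _ e e0; near=> q.
  by rewrite c0 big_ord0; exact: close1.
- move=> _ e e0; near=> q.
  by rewrite c1 big_ord1; near: q; exact: closeM.
- (* With d <= 1, the product contributes 2 d + d ^ 2 <= 3 d and the correction
     d (1 + d) <= 2 d, whence the constant 5. *)
  move=> nN e e0; pose d := Num.min 1 (e / 5).
  have d0 : 0 < d by rewrite lt_min ltr01 divr_gt0.
  have d1 : d <= 1 by rewrite ge_min lexx.
  have d5 : 5 * d <= e by rewrite mulrC -ler_pdivlMr// ge_min lexx orbT.
  have n1N := ltnW nN; have n0N := ltnW n1N.
  near=> q.
  have clc : coef_close d (c n q) (\prod_(i < n) B i q).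
    by near: q; exact: IH0.
  have clc1 : coef_close d (c n.+1 q) (\prod_(i < n.+1) B i q).
    by near: q; exact: IH1.
  have clM : coef_close d (M n.+1 q) (B n.+1 q) by near: q; exact: closeM.
  have clM0 : coef_close d (M n q) (B n q) by near: q; exact: closeM.
  have Tq : `|T n q| <= d * ((B n q)`_0 * (B n.+1 q)`_0).
    by near: q; exact: smallT.
  move=> j; rewrite cS coefB coefZ.
  have h1 := coef_closeM d0 d0 clc1 clM j.
  rewrite [\prod_(i < n.+2) _]big_ord_recr /=.
  set u := (c n.+1 q * _)`_j in h1 *; set v := (_ * B n.+1 q)`_j in h1 *.
  have g0 i := coef_close_ge0 i d0 clc.
  have g1 i := coef_close_ge0 i d0 clc1.
  have b0 i := coef_close_ge0 i d0 clM.
  have b00 i := coef_close_ge0 i d0 clM0.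
  have h2 : (\prod_(i < n) B i q)`_j * ((B n q)`_0 * (B n.+1 q)`_0) <= v.
    apply: le_trans (ler_coefM_coef0 _ g1 b0).
    rewrite mulrA ler_wpM2r// [leRHS](_ : _ = (\prod_(i < n) B i q * B n q)`_j).
      exact: ler_coefM_coef0.
    by rewrite big_ord_recr.
  have h3 : `|T n q * (c n q)`_j| <= d * 2 * v.
    rewrite normrM; apply: le_trans
      (_ : d * ((B n q)`_0 * (B n.+1 q)`_0) * (2 * (\prod_(i < n) B i q)`_j) <= _).
      apply: ler_pM => //; apply: le_trans (coef_close_norm j d0 clc) _.
      by rewrite ler_wpM2r//; lra.
    rewrite [leLHS](_ : _ =
      d * 2 * ((\prod_(i < n) B i q)`_j * ((B n q)`_0 * (B n.+1 q)`_0))); last ring.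
    by rewrite ler_wpM2l// mulr_ge0// ltW.
  have v0 : 0 <= v by apply: le_trans h2; rewrite !mulr_ge0.
  rewrite addrAC; apply: le_trans (ler_normB _ _) _.
  apply: le_trans (lerD h1 h3) _; rewrite -mulrDl ler_wpM2r//; nra.
Unshelve. all: by end_near. Qed.

End CoefClose.

(** * Roots of a polynomial close to a product over separated scales *)

Section Roots.
Variable R : realType.
Implicit Types (p : {poly R}) (e x : R).

(** The value at [- x] involves cancellation, but the coefficientwise errors
    add up to at most [e] times the cancellation-free value [p'.[x]]. *)
Lemma coef_close_horner e p p' x : 0 <= x -> coef_close e p p' ->
  `|p.[- x] - p'.[- x]| <= e * p'.[x].
Proof.
move=> x0 cl; pose n := maxn (size p) (size p').
rewrite (horner_coef_wide _ (leq_maxl _ _ : (size p <= n)%N)).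
rewrite !(horner_coef_wide _ (leq_maxr _ _ : (size p' <= n)%N)).
rewrite -sumrB mulr_sumr; apply: le_trans (ler_norm_sum _ _ _) _.
apply: ler_sum => i _; rewrite -mulrBl normrM normrX normrN (ger0_norm x0).
by rewrite mulrA ler_wpM2r// exprn_ge0.
Qed.

Lemma poly_ivt_mul p (a b : R) : a <= b -> p.[a] * p.[b] <= 0 ->
  exists2 x, a <= x <= b & p.[x] = 0.
Proof.
move=> ab pab.
have [pa|pa] := leP p.[a] 0; have [pb|pb] := leP 0 p.[b].
- by have [|x xab /rootP] := poly_ivt (p := p) ab; [rewrite pa pb | exists x].
- exists a; first by rewrite lexx.
  by apply/eqP; rewrite eq_le pa/=; nra.
- exists b; first by rewrite lexx ab.
  by apply/eqP; rewrite eq_le pb/= andbT; nra.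
- have [|x xab /rootP] := poly_ivt (p := - p) ab.
    by rewrite !hornerN oppr_le0 oppr_ge0 !ltW.
  by rewrite hornerN => /eqP; rewrite oppr_eq0 => /eqP px; exists x.
Qed.

(** The polynomial [P] approximated by [p] satisfies
    [`|P.[- x]| >= (d / 3) ^+ n * P.[x]] at [x = a k * (1 +- d)]: for [i != k]
    the scales [a i] and [x] are far apart, and for [i = k] the factor is
    [d * a k], to be compared with [a k * (2 +- d) <= 3 * a k].  As [e] is
    smaller than that constant, [p] has the sign of [P] at both points, and
    [P] changes sign between them because only its k-th factor does.  The
    separation factor 6 is one for which [a k / 2 <= x <= 3 / 2 * a k] keeps
    the other [a i] away from [x]. *)
Lemma root_near_scale (n k : nat) (a : nat -> R) (C e d : R) p :
  0 < C -> (forall i, (i < n)%N -> 0 < a i) ->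
  (forall i j, (i < j < n)%N -> 6 * a i <= a j) ->
  0 < d <= 1 / 2 -> e < (d / 3) ^+ n -> (k < n)%N ->
  coef_close e p (C *: \prod_(i < n) ('X + (a i)%:P)) ->
  exists2 x, `|x - 1| <= d & p.[- (a k * x)] = 0.
Proof.
move=> C0 a0 asep /andP[d0 d1] ed kn cl.
set P := _ *: _ in cl.
have PE x : P.[x] = C * \prod_(i < n) (x + a i).
  rewrite hornerZ horner_prod; congr (_ * _); apply: eq_bigr => i _.
  by rewrite !hornerE.
have ak := a0 k kn.
have sign s : 0 < s -> `|s - 1| = d -> 0 < p.[- (a k * s)] * P.[- (a k * s)].
  move=> s0 sd; have x0 : 0 < a k * s by rewrite mulr_gt0.
  have h := coef_close_horner (ltW x0) cl.
  set x := a k * s in h x0 *.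
  have : `|s - 1| <= 1 / 2 by rewrite sd.
  rewrite ler_norml => /andP[sl su].
  have Pgt : 0 < P.[x].
    by rewrite PE mulr_gt0// prodr_gt0// => i _; rewrite addr_gt0// a0.
  have Pbig : (d / 3) ^+ n * P.[x] <= `|P.[- x]|.
    rewrite !PE normrM gtr0_norm// mulrCA ler_pM2l//.
    rewrite -{1}(card_ord n) -prodr_const -big_split/= normr_prod.
    apply: ler_prod => i _; have ai := a0 i (ltn_ord i).
    apply/andP; split; first by rewrite mulr_ge0 ?addr_ge0 ?divr_ge0 ?ltW.
    have xl : a k / 2 <= x by rewrite /x ler_pM2l//; lra.
    have xu : x <= 3 / 2 * a k by rewrite mulrC /x ler_pM2l//; lra.
    have d6 : d / 3 * (x + a i) <= 1 / 6 * (x + a i).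
      by rewrite ler_wpM2r ?(ltW (addr_gt0 x0 ai))//; lra.
    rewrite (addrC (- x)).
    have [ik|ki|->] := ltngtP i k.
    - have := asep i k; rewrite ik kn => /(_ isT) h6.
      rewrite distrC; apply: le_trans (ler_norm _); lra.
    - have := asep k i; rewrite ki ltn_ord => /(_ isT) h6.
      apply: le_trans (ler_norm _); lra.
    - rewrite /x -[X in X - _]mulr1 -mulrBr normrM (gtr0_norm ak) distrC sd.
      have : d * x <= d * (3 / 2 * a k) by rewrite ler_pM2l.
      have : 0 < d * a k by rewrite mulr_gt0.
      by rewrite /x; lra.
  have : `|p.[- x] - P.[- x]| < `|P.[- x]|.
    by apply: le_lt_trans h _; apply: lt_le_trans Pbig; rewrite ltr_pM2r.
  have [P0|P0] := ger0P P.[- x]; rewrite ltr_norml => /andP[? ?].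
    by rewrite mulr_gt0//; lra.
  by rewrite -mulrNN mulr_gt0//; lra.
have Pneg : P.[- (a k * (1 + d))] * P.[- (a k * (1 - d))] < 0.
  rewrite !PE mulrACA -big_split/= pmulr_rlt0 ?mulr_gt0//.
  rewrite (bigD1 (Ordinal kn))//= nmulr_rlt0; last first.
    have -> : (- (a k * (1 + d)) + a k) * (- (a k * (1 - d)) + a k) = - (a k * d) ^+ 2.
      by ring.
    by rewrite oppr_lt0 exprn_gt0// mulr_gt0.
  apply: prodr_gt0 => i ik; have ai := a0 i (ltn_ord i).
  have {ik} : (i != k :> nat) by [].
  rewrite neq_ltn => /orP[ik|ki].
  - have := asep i k; rewrite ik kn => /(_ isT) h6.
    by rewrite -mulrNN mulr_gt0//; nra.
  - have := asep k i; rewrite ki ltn_ord => /(_ isT) h6.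
    by rewrite mulr_gt0//; nra.
have s1 : 0 < p.[- (a k * (1 + d))] * P.[- (a k * (1 + d))].
  by apply: sign; [lra | rewrite addrAC subrr add0r gtr0_norm].
have s2 : 0 < p.[- (a k * (1 - d))] * P.[- (a k * (1 - d))].
  by apply: sign; [lra | rewrite addrAC subrr add0r normrN gtr0_norm].
have [||y /andP[y1 y2] py] := @poly_ivt_mul p (- (a k * (1 + d))) (- (a k * (1 - d))).
- by rewrite lerN2 ler_pM2l//; lra.
- nra.
exists (- y / a k); last by rewrite mulrC divfK ?gt_eqF// opprK.
rewrite ler_norml lerBrDr lerBlDr ler_pdivlMr// ler_pdivrMr//.
by apply/andP; split; lra.
Qed.

End Roots.

(** * Asymptotic equivalence at 0+ *)

Section Asymp.
Variable R : realType.
Implicit Types (a b : R -> R).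

Lemma asymp_near_le a b : asymp a b -> (\forall q \near 0^'+, 0 < b q) ->
  forall e, 0 < e -> \forall q \near 0^'+, `|a q - b q| <= e * b q.
Proof.
move=> /cvgrPdist_le ab b0 e e0; near=> q.
have bq : 0 < b q by near: q.
have := near (ab e e0) q; rewrite distrC => h.
rewrite -ler_pdivrMr// -[X in _ / X](gtr0_norm bq) -normf_div mulrBl divff ?gt_eqF//.
by apply: h.
Unshelve. all: by end_near. Qed.

Lemma near_le_asymp a b : (\forall q \near 0^'+, 0 < b q) ->
  (forall e, 0 < e -> \forall q \near 0^'+, `|a q - b q| <= e * b q) -> asymp a b.
Proof.
move=> b0 ab; apply/cvgrPdist_le => e e0; near=> q.
have bq : 0 < b q by near: q.
rewrite distrC -[X in _ - X](divff (lt0r_neq0 bq)) -mulrBl normf_div (gtr0_norm bq).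
by rewrite ler_pdivrMr//; near: q; exact: ab.
Unshelve. all: by end_near. Qed.

Lemma near_eq_asymp a a' b b' : (\forall q \near 0^'+, a q = a' q) ->
  (\forall q \near 0^'+, b q = b' q) -> asymp a' b' -> asymp a b.
Proof.
move=> aa bb; rewrite /asymp; apply: cvg_trans; apply: near_eq_cvg; near=> q.
by rewrite (near aa q)// (near bb q).
Unshelve. all: by end_near. Qed.

Lemma asympM a a' b b' : asymp a b -> asymp a' b' ->
  asymp (fun q => a q * a' q) (fun q => b q * b' q).
Proof.
move=> ab ab'; rewrite /asymp -[X in _ --> X]mulr1; apply: cvg_trans (cvgM ab ab').
by apply: near_eq_cvg; near=> q; rewrite /= invfM mulrACA.
Unshelve. all: by end_near. Qed.

Lemma asympV a b : asymp a b -> asymp (fun q => (a q)^-1) (fun q => (b q)^-1).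
Proof.
move=> ab; rewrite /asymp -[X in _ --> X]invr1.
apply: cvg_trans (cvgV (oner_neq0 R) ab).
by apply: near_eq_cvg; near=> q; rewrite /= invfM.
Unshelve. all: by end_near. Qed.

Lemma asymp_refl b : (\forall q \near 0^'+, 0 < b q) -> asymp b b.
Proof.
move=> b0; apply: near_le_asymp => // e e0; near=> q.
by rewrite subrr normr0 mulr_ge0// ltW//; near: q.
Unshelve. all: by end_near. Qed.

Lemma asymp_negligible a b d : asymp a b -> (\forall q \near 0^'+, 0 < b q) ->
  (\forall q \near 0^'+, 0 < d q) ->
  b q / d q @[q --> 0^'+] --> (0 : R) ->
  forall e, 0 < e -> \forall q \near 0^'+, `|a q| <= e * d q.
Proof.
move=> ab b0 d0 bd e e0.
have ad : a q / b q * (b q / d q) @[q --> 0^'+] --> (0 : R).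
  by rewrite -[X in _ --> X](mulr0 1); apply: cvgM.
move/cvgrPdist_le : ad => /(_ e e0) ad; near=> q.
have bq : 0 < b q by near: q.
have dq : 0 < d q by near: q.
have := near ad q; rewrite sub0r normrN mulrA divfK ?gt_eqF//.
by rewrite normf_div (gtr0_norm dq) ler_pdivrMr//; apply.
Unshelve. all: by end_near. Qed.

Lemma near0_gt0 (P : R -> Prop) : (forall q, 0 < q < 1 -> P q) ->
  \forall q \near 0^'+, P q.
Proof.
move=> h; near=> q; apply: h.
by apply/andP; split; near: q; [exact: nbhs_right_gt | exact: nbhs_right_lt].
Unshelve. all: by end_near. Qed.

Lemma cvg_1BpowR (e : R) : 0 < e -> (1 - q `^ e) @[q --> 0^'+] --> (1 : R).
Proof.
move=> e0; rewrite -[X in _ --> X]subr0.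
by apply: cvgB; [exact: cvg_cst | exact: powR_cvg0].
Qed.

Lemma asymp_1BpowR_gt0 (e : R) : 0 < e -> asymp (fun q => 1 - q `^ e) (cst 1).
Proof.
move=> /cvg_1BpowR; rewrite /asymp; apply: cvg_trans; apply: near_eq_cvg.
by apply: near0_gt0 => q _; rewrite divr1.
Qed.

(** The quotient of the two sides is [1 - q `^ (- e)]. *)
Lemma asymp_1BpowR_lt0 (e : R) : e < 0 ->
  asymp (fun q => 1 - q `^ e) (fun q => - q `^ e).
Proof.
move=> e0; have : 0 < - e by rewrite oppr_gt0.
move=> /cvg_1BpowR; rewrite /asymp; apply: cvg_trans; apply: near_eq_cvg.
apply: near0_gt0 => q /andP[q0 _].
by rewrite invrN mulrN mulrBl divff ?gt_eqF ?powR_gt0// mul1r powRN opprB.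
Qed.

(** A diagonal choice: pick a point of [P q] whose distance to [l] exceeds the
    infimum of these distances by less than [q].  The choice does not depend
    on [d], and the excess [q] itself tends to 0. *)
Lemma select_cvg (P : R -> set R) (l : R) :
  (forall d, 0 < d <= 1 / 2 ->
     \forall q \near 0^'+, exists2 x, `|x - l| <= d & P q x) ->
  exists f : R -> R,
    (\forall q \near 0^'+, P q (f q)) /\ f q @[q --> 0^'+] --> l.
Proof.
move=> H; pose S q := [set `|x - l| | x in P q].
have lbS q : has_lbound (S q) by exists 0 => _ [x _ <-].
have : forall q, exists y, 0 < q -> P q !=set0 -> P q y /\ `|y - l| < inf (S q) + q.
  move=> q; have [q0|] := pselect (0 < q); last by exists 0.
  have [[x Px]|] := pselect (P q !=set0); last by exists 0.
  have [||_ [y Py <-] ylt] := @inf_adherent R (S q) q; first exact: q0.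
    by split => //; exists `|x - l|, x.
  by exists y.
move=> /choice[f fP]; exists f.
have near_f d : 0 < d <= 1 / 2 ->
    \forall q \near 0^'+, P q (f q) /\ `|f q - l| <= d + q.
  move=> d0; near=> q.
  have q0 : 0 < q by near: q; exact: nbhs_right_gt.
  have [x xd Px] : exists2 x, `|x - l| <= d & P q x by near: q; exact: H.
  have [|Pf lt_f] := fP q q0; first by exists x.
  split => //; apply: le_trans (ltW lt_f) _; rewrite lerD2r.
  by apply: le_trans xd; apply: ge_inf => //; exists x.
split.
  have : \forall q \near 0^'+, P q (f q) /\ `|f q - l| <= 1 / 2 + q.
    by apply: near_f; rewrite lexx divr_gt0.
  by apply: filterS => q [].
apply/cvgrPdist_le => e e0; pose d := Num.min (1 / 2) (e / 2).
have d0 : 0 < d <= 1 / 2 by rewrite lt_min ge_min lexx !divr_gt0.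
have de : d <= e / 2 by rewrite ge_min lexx orbT.
near=> q; have [//|_ fd] := near (near_f d d0) q.
rewrite distrC; apply: le_trans fd _.
have : q < e / 2 by near: q; apply: nbhs_right_lt; rewrite divr_gt0.
by lra.
Unshelve. all: by end_near. Qed.

End Asymp.

(** * Leading behaviour of the recurrence *)

Section Leading.
Variables (R : realType) (t1 t2 h1 h2 l1 l2 alpha1 alpha2 beta : R).
Local Notation lam := (lambda1 h1 h2 l1 l2 alpha1 alpha2 beta).
Hypotheses (t1_gt0 : 0 < t1) (t2_gt0 : 0 < t2) (beta_lt1 : beta < 1).

(** [factor] and [correction] are the coefficients of the recurrence solved for
    its highest term.  Indices start at 0: [factor n] produces [c_(n+1)], while
    [correction n] multiplies [c_n] in the formula for [c_(n+2)]. *)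
Definition factor (n : nat) (q : R) : {poly R} :=
  (c_lead t1 t2 h1 h2 beta q n.+1)^-1 *:
    c_bracket t1 t2 h1 h2 l1 l2 alpha1 alpha2 beta q n.+1.

Definition correction (n : nat) (q : R) : R :=
  (c_lead t1 t2 h1 h2 beta q n.+2)^-1 *
    c_trail h1 h2 l1 l2 alpha1 alpha2 beta q n.+2.

Definition leading_scale (n : nat) (q : R) : R :=
  (t1 * t2)^-1 * q `^ (n%:R + lam - h1 - h2).

Definition leading_root (n : nat) (q : R) : R :=
  q `^ (1 / 2 - n%:R + h1 - lam) * t1.

Definition leading_factor (n : nat) (q : R) : {poly R} :=
  leading_scale n q *: ('X + (leading_root n q)%:P).

Lemma powR_add (q x y : R) : 0 < q -> q `^ (x + y) = q `^ x * q `^ y.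
Proof. by move=> q0; rewrite powRD// (gt_eqF q0) implybT. Qed.

Lemma leading_scale_gt0 n q : 0 < q -> 0 < leading_scale n q.
Proof. by move=> q0; rewrite mulr_gt0 ?powR_gt0 ?invr_gt0 ?mulr_gt0. Qed.

Lemma leading_root_gt0 n q : 0 < q -> 0 < leading_root n q.
Proof. by move=> q0; rewrite mulr_gt0 ?powR_gt0. Qed.

Lemma leading_rootS n q : 0 < q -> leading_root n q = q * leading_root n.+1 q.
Proof.
move=> q0; rewrite /leading_root mulrA -{2}(powRr1 (ltW q0)) -powR_add//.
by congr (_ `^ _ * _); rewrite -(natr1 n); ring.
Qed.

Lemma c_poly_factor1 q :
  c_poly t1 t2 h1 h2 l1 l2 alpha1 alpha2 beta q 1 = factor 0 q.
Proof. by rewrite /= scaler0 subr0 mul1r. Qed.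

Lemma c_poly_factorS n q :
  c_poly t1 t2 h1 h2 l1 l2 alpha1 alpha2 beta q n.+2 =
  c_poly t1 t2 h1 h2 l1 l2 alpha1 alpha2 beta q n.+1 * factor n.+1 q
  - correction n q *: c_poly t1 t2 h1 h2 l1 l2 alpha1 alpha2 beta q n.
Proof. by rewrite [LHS]/= scalerBr scalerA scalerAr. Qed.

Lemma asymp_c_lead n : asymp (fun q => c_lead t1 t2 h1 h2 beta q n.+1)
  (fun q => t1 * t2 * q `^ (h1 + h2)).
Proof.
have nb : 0 < n.+1%:R - beta by rewrite subr_gt0 (lt_le_trans beta_lt1)// ler1n.
have n0 : 0 < n.+1%:R :> R by [].
apply: near_eq_asymp
  (asympM (asympM (asymp_refl _) (asymp_1BpowR_gt0 n0)) (asymp_1BpowR_gt0 nb)).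
- apply: near0_gt0 => q /andP[q0 _].
  by rewrite /c_lead powR_mulrn// ltW.
- by apply: near0_gt0 => q _; rewrite !mulr1.
- by apply: near0_gt0 => q /andP[q0 _]; rewrite !mulr_gt0// powR_gt0.
Qed.

(** Divided by [q `^ (1 / 2 + h1) * t1], the constant coefficient is
    [1 + q^(h2-h1) r + q^g (1 + q^(l2-l1) r)] with [r = t2 / t1] and
    [g = 2 n + 1 + h2 - l2 - beta], the value of [g] coming from the
    definition of [lambda1]; all three exponents are positive. *)
Lemma asymp_c_bracket0 n : h1 < h2 -> l1 < l2 -> 0 < 1 + h2 - l2 - beta ->
  asymp
    (fun q => (c_bracket t1 t2 h1 h2 l1 l2 alpha1 alpha2 beta q n.+1)`_0)
    (fun q => q `^ (1 / 2 + h1) * t1).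
Proof.
move=> hh hl hc1.
have g0 : 0 < 2 * n%:R + (1 + h2 - l2 - beta) by rewrite ltr_wpDl// mulr_ge0.
have cvgg := powR_cvg0 g0.
have cvgh : q `^ (h2 - h1) @[q --> 0^'+] --> (0 : R).
  by apply: powR_cvg0; rewrite subr_gt0.
have cvgl : q `^ (l2 - l1) @[q --> 0^'+] --> (0 : R).
  by apply: powR_cvg0; rewrite subr_gt0.
pose r := t2 / t1.
have : (1 + q `^ (h2 - h1) * r +
    q `^ (2 * n%:R + (1 + h2 - l2 - beta)) * (1 + q `^ (l2 - l1) * r))
    @[q --> 0^'+] --> (1 + 0 * r + 0 * (1 + 0 * r) : R).
  apply: cvgD; first by apply: cvgD; [exact: cvg_cst | apply: cvgM => //; exact: cvg_cst].
  apply: cvgM => //.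
  by apply: cvgD; [exact: cvg_cst | apply: cvgM => //; exact: cvg_cst].
rewrite !mul0r !addr0 /asymp; apply: cvg_trans; apply: near_eq_cvg.
apply: near0_gt0 => q /andP[q0 _].
rewrite /c_bracket coefD coefZ coefX coefC/= mulr0 add0r.
have pD x y := powR_add x y q0.
have -> : q `^ h2 = q `^ h1 * q `^ (h2 - h1) by rewrite -pD subrKC.
have -> : q `^ l2 = q `^ l1 * q `^ (l2 - l1) by rewrite -pD subrKC.
have <- : q `^ (1 / 2) * q `^ h1 * q `^ (2 * n%:R + (1 + h2 - l2 - beta)) / q `^ l1
    = q `^ (2 * (n.+1%:R - 1 + lam) + alpha1 + alpha2 - 1 / 2).
  rewrite -powRN -!pD; congr (_ `^ _); rewrite -(natr1 n) /lambda1.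
  by field.
rewrite (pD (1 / 2)) /r.
have z1 : q `^ (1 / 2) != 0 by rewrite gt_eqF ?powR_gt0.
have z2 : q `^ h1 != 0 by rewrite gt_eqF ?powR_gt0.
have z3 : q `^ l1 != 0 by rewrite gt_eqF ?powR_gt0.
have z4 : t1 != 0 by rewrite gt_eqF.
by field; rewrite z1 z2 z3 z4.
Qed.

Lemma factor_close n : h1 < h2 -> l1 < l2 -> 0 < 1 + h2 - l2 - beta ->
  forall e, 0 < e ->
    \forall q \near 0^'+, coef_close e (factor n q) (leading_factor n q).
Proof.
move=> hh hl hc1 e e0.
have inv_lead := asympV (asymp_c_lead n).
have close0 : asymp (fun q => (factor n q)`_0) (fun q => (leading_factor n q)`_0).
  apply: near_eq_asymp (asympM inv_lead (asymp_c_bracket0 n hh hl hc1)).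
    by apply: near0_gt0 => q _; rewrite coefZ.
  apply: near0_gt0 => q /andP[q0 _].
  rewrite coefZ coefD coefX coefC/= add0r /leading_scale /leading_root.
  have -> : q `^ (1 / 2 + h1) = q `^ (n%:R + lam - h1 - h2) *
      q `^ (1 / 2 - n%:R + h1 - lam) * q `^ (h1 + h2).
    by rewrite -!powR_add//; congr (_ `^ _); ring.
  by field; rewrite !gt_eqF ?powR_gt0.
have close1 : asymp (fun q => (factor n q)`_1) (fun q => (leading_factor n q)`_1).
  apply: near_eq_asymp (asympM inv_lead (asymp_refl _)); last first.
  - apply: near0_gt0 => q /andP[q0 _]; exact: (powR_gt0 (n.+1%:R - 1 + lam) q0).
  - apply: near0_gt0 => q /andP[q0 _].
    rewrite coefZ coefD coefX coefC/= addr0 mulr1 /leading_scale.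
    rewrite [in RHS]invfM -[in RHS]powRN -mulrA -powR_add//.
    by congr (_ * _ `^ _); rewrite -(natr1 n); ring.
  - apply: near0_gt0 => q _.
    by rewrite coefZ coefD coefZ coefX coefC/= addr0 mulr1.
have pos0 : \forall q \near 0^'+, 0 < (leading_factor n q)`_0.
  apply: near0_gt0 => q /andP[q0 _].
  by rewrite coefZ coefD coefX coefC/= add0r mulr_gt0 ?leading_scale_gt0 ?leading_root_gt0.
have pos1 : \forall q \near 0^'+, 0 < (leading_factor n q)`_1.
  apply: near0_gt0 => q /andP[q0 _].
  by rewrite coefZ coefD coefX coefC/= addr0 mulr1 leading_scale_gt0.
near=> q; case=> [|[|j]].
- by near: q; exact: asymp_near_le.
- by near: q; exact: asymp_near_le.
- rewrite /factor /leading_factor /c_bracket !(coefZ, coefD, coefX, coefC)/=.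
  by rewrite !(mulr0, addr0) subrr normr0.
Unshelve. all: by end_near. Qed.

(** With [u] and [v] the exponents in [c_trail], both negative because
    [u = n - N] and [v = u + alpha2 - alpha1], the correction is equivalent to
    [q^(1 + u + v - h1 - h2) / (t1 t2)].  The two constant coefficients
    multiply to [q^(1 - 2 h2) / t2 ^ 2], and the quotient is [t2 / t1] times
    a power of q whose exponent is
    [2 n + 2 + 2 h2 - l1 - l2 - beta > 0]. *)
Lemma correction_negligible (N n : nat) : N%:R = - lam - alpha1 ->
  alpha2 - alpha1 < 1 -> 0 < 2 + 2 * h2 - l1 - l2 - beta -> (n < N)%N ->
  forall e, 0 < e -> \forall q \near 0^'+,
    `|correction n q| <=
      e * ((leading_factor n q)`_0 * (leading_factor n.+1 q)`_0).
Proof.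
move=> hN halpha hc2 nN.
pose u := n.+2%:R - 2 + lam + alpha1; pose v := n.+2%:R - 2 + lam + alpha2.
have nN' : n%:R + 1 <= N%:R :> R by rewrite natr1 ler_nat.
have nE : n.+2%:R = n%:R + 2 :> R by rewrite -addn2 natrD.
have u0 : u < 0 by rewrite /u nE; lra.
have v0 : v < 0 by rewrite /v nE; lra.
have B0 m q : (leading_factor m q)`_0 = leading_scale m q * leading_root m q.
  by rewrite coefZ coefD coefX coefC/= add0r.
have pow_gt0 x : \forall q \near 0^'+, 0 < q `^ x :> R.
  by apply: near0_gt0 => q /andP[q0 _]; exact: powR_gt0.
apply: (@asymp_negligible _ _ (fun q => (t1 * t2)^-1 * q `^ (1 + u + v - (h1 + h2)))).
- apply: near_eq_asymp (asympM (asympV (asymp_c_lead n.+1))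
    (asympM (asympM (asymp_refl (pow_gt0 1)) (asymp_1BpowR_lt0 u0))
      (asymp_1BpowR_lt0 v0))).
    apply: near0_gt0 => q /andP[q0 _].
    by rewrite /correction /c_trail powRr1// ltW.
  apply: near0_gt0 => q /andP[q0 _].
  rewrite !(mulrN, mulNr) opprK [(t1 * t2 * _)^-1]invfM -powRN -!powR_add//.
  rewrite -mulrA -powR_add//.
  by congr (_ * _ `^ _); ring.
- apply: near0_gt0 => q /andP[q0 _].
  by rewrite mulr_gt0 ?powR_gt0// invr_gt0 mulr_gt0.
- apply: near0_gt0 => q /andP[q0 _].
  rewrite !B0; apply: mulr_gt0; apply: mulr_gt0.
  - exact: leading_scale_gt0.
  - exact: leading_root_gt0.
  - exact: leading_scale_gt0.
  - exact: leading_root_gt0.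
have g0 : 0 < 2 * n%:R + (2 + 2 * h2 - l1 - l2 - beta).
  by rewrite ltr_wpDl// mulr_ge0.
have : t2 / t1 * q `^ (2 * n%:R + (2 + 2 * h2 - l1 - l2 - beta))
    @[q --> 0^'+] --> (t2 / t1 * 0 : R).
  by apply: cvgM; [exact: cvg_cst | exact: powR_cvg0].
rewrite mulr0; apply: cvg_trans; apply: near_eq_cvg.
apply: near0_gt0 => q /andP[q0 _].
have pD x y := powR_add x y q0.
have BB : (leading_factor n q)`_0 * (leading_factor n.+1 q)`_0 =
    t2 ^- 2 * q `^ (1 - 2 * h2).
  rewrite !B0 /leading_scale /leading_root.
  have -> : q `^ (1 - 2 * h2) = q `^ (n%:R + lam - h1 - h2) *
    q `^ (1 / 2 - n%:R + h1 - lam) * q `^ (n.+1%:R + lam - h1 - h2) *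
    q `^ (1 / 2 - n.+1%:R + h1 - lam) by rewrite -!pD; congr (_ `^ _); field.
  by field; rewrite !gt_eqF.
rewrite BB [(t2 ^- 2 * _)^-1]invfM invrK mulrACA -powRN -pD.
have -> : 2 * n%:R + (2 + 2 * h2 - l1 - l2 - beta) =
    1 + u + v - (h1 + h2) - (1 - 2 * h2).
  by rewrite /u /v nE /lambda1; field.
by congr (_ * _); field; rewrite !gt_eqF.
Qed.

Lemma c_poly_close (N : nat) : N%:R = - lam - alpha1 ->
  alpha2 - alpha1 < 1 -> h1 < h2 -> l1 < l2 ->
  0 < 1 + h2 - l2 - beta -> 0 < 2 + 2 * h2 - l1 - l2 - beta ->
  forall e, 0 < e -> \forall q \near 0^'+,
    coef_close e (c_poly t1 t2 h1 h2 l1 l2 alpha1 alpha2 beta q N.+1)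
      (\prod_(i < N.+1) leading_factor i q).
Proof.
move=> hN halpha hh hl hc1 hc2 e e0.
apply: (coef_close_recurrence (M := factor) (T := correction) (N := N)
  (c := fun n q => c_poly t1 t2 h1 h2 l1 l2 alpha1 alpha2 beta q n)) => //.
- exact: c_poly_factor1.
- by move=> n q; exact: c_poly_factorS.
- by move=> n _; exact: factor_close.
- by move=> n nN; exact: correction_negligible nN.
Qed.

Lemma prod_leading_scale n q : 0 < q ->
  \prod_(i < n.+1) leading_scale i q =
  (t1 * t2) ^- n.+1 * q `^ ((n%:R / 2 + lam - h1 - h2) * (n%:R + 1)).
Proof.
move=> q0; elim: n => [|n IH].
  by rewrite big_ord1 /leading_scale expr1 /=; congr (_ * _ `^ _); field.
rewrite big_ord_recr/= IH /leading_scale mulrACA -powR_add// -invfM -exprSr.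
congr (_ * _ `^ _); by rewrite -(natr1 n); field.
Qed.

Lemma prod_leading_factor N q : 0 < q ->
  \prod_(i < N.+1) leading_factor i q =
  ((t1 * t2) ^- N.+1 * q `^ ((N%:R / 2 + lam - h1 - h2) * (N%:R + 1))) *:
    \prod_(1 <= k < N.+2) ('X + (q `^ (3 / 2 - k%:R + h1 - lam) * t1)%:P).
Proof.
move=> q0; rewrite scaler_prod prod_leading_scale//; congr (_ *: _).
rewrite big_add1/= big_mkord; apply: eq_bigr => i _.
by congr (_ + (_ `^ _ * _)%:P); rewrite -(natr1 i); field.
Qed.

End Leading.

(** * Degrees and positivity *)

Lemma size_XaddC_prod (R : realType) (a : nat -> R) n :
  size (\prod_(i < n) ('X + (a i)%:P)) = n.+1.
Proof.
have -> : \prod_(i < n) ('X + (a i)%:P) = \prod_(i < n) ('X - (- a i)%:P).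
  by apply: eq_bigr => i _; rewrite polyCN opprK.
by rewrite size_prod_XsubC /index_enum -enumT size_enum_ord.
Qed.

Lemma coef_prod_XaddC_gt0 (R : realType) (a : nat -> R) n :
  (forall i, 0 < a i) ->
  forall j, (j <= n)%N -> 0 < (\prod_(i < n) ('X + (a i)%:P))`_j.
Proof.
move=> a0; elim: n => [|n IH] j.
  by rewrite leqn0 => /eqP ->; rewrite big_ord0 coef1.
rewrite big_ord_recr/= mulrDr coefD coefMX coefMC => jn.
case: j jn => [_|j jn] /=; first by rewrite add0r mulr_gt0 ?IH.
apply: ltr_wpDr; last exact: IH.
rewrite mulr_ge0 ?(ltW (a0 n))//.
have [jn'|jn'] := leqP j.+1 n; first exact/ltW/IH.
by rewrite nth_default// size_XaddC_prod.
Qed.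

Lemma size_c_poly (R : realType) (t1 t2 h1 h2 l1 l2 alpha1 alpha2 beta q : R) n :
  (size (c_poly t1 t2 h1 h2 l1 l2 alpha1 alpha2 beta q n) <= n.+1)%N.
Proof.
suff : (size (c_poly t1 t2 h1 h2 l1 l2 alpha1 alpha2 beta q n) <= n.+1)%N /\
  (size (c_poly t1 t2 h1 h2 l1 l2 alpha1 alpha2 beta q n.+1) <= n.+2)%N by case.
have szb m : (size (c_bracket t1 t2 h1 h2 l1 l2 alpha1 alpha2 beta q m) <= 2)%N.
  apply: leq_trans (size_polyD _ _) _; rewrite geq_max.
  rewrite (leq_trans (size_scale_leq _ _)) ?size_polyX//=.
  by rewrite (leq_trans (size_polyC_leq1 _)).
have step m (p r : {poly R}) s t : (size p <= m.+1)%N -> (size r <= m.+2)%N ->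
    (size (s *: (p * c_bracket t1 t2 h1 h2 l1 l2 alpha1 alpha2 beta q m.+1
      - t *: r)) <= m.+2)%N.
  move=> sp sr; apply: leq_trans (size_scale_leq _ _) _.
  apply: leq_trans (size_polyD _ _) _; rewrite geq_max size_polyN.
  rewrite (leq_trans (size_scale_leq _ _))// andbT.
  apply: leq_trans (size_polyMleq _ _) _.
  by have := leq_add sp (szb m.+1); rewrite addn2; case: (_ + _)%N.
elim: n => [|n [IH0 IH1]]; split=> //.
- by rewrite size_poly1.
- by apply: step; rewrite ?size_poly1 ?size_poly0.
- by apply: step => //; apply: leq_trans IH0 _; rewrite ltnW.
Qed.

Lemma near_forall_leq (R : realType) (F : set_system R) (FF : Filter F)
    (n : nat) (P : nat -> R -> Prop) :
  (forall k, (k <= n)%N -> \forall q \near F, P k q) ->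
  \forall q \near F, forall k, (k <= n)%N -> P k q.
Proof.
elim: n => [|n IH] h.
  by apply: filterS (h 0%N (leqnn 0)) => q Pq k; rewrite leqn0 => /eqP ->.
apply: filterS (filterI (IH (fun k kn => h k (leqW kn))) (h n.+1 (leqnn _))).
move=> q [Pn Pn1] k; rewrite leq_eqVlt => /orP[/eqP -> //|].
exact: Pn.
Qed.

(** The factor 6 is that of [root_near_scale]; it is at least 1, so that the
    gap persists along the sequence. *)
Lemma geometric_sep (R : realDomainType) (a : nat -> R) :
  (forall i, 0 < a i) -> (forall i, 6 * a i <= a i.+1) ->
  forall i j, (i < j)%N -> 6 * a i <= a j.
Proof.
move=> a0 aS i; elim=> // j IH.
rewrite ltnS leq_eqVlt => /orP[/eqP <- //|/IH ij].
by apply: le_trans ij _; apply: le_trans (aS j); have := a0 j; lra.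
Qed.

(** * The theorem *)

Theorem theorem4p2 (R : realType)
    (t1 t2 h1 h2 l1 l2 alpha1 alpha2 beta : R) (N : nat)
    (lam := lambda1 h1 h2 l1 l2 alpha1 alpha2 beta)
    (c := fun q : R => c_poly t1 t2 h1 h2 l1 l2 alpha1 alpha2 beta q N.+1)
    (hN : N%:R = - lam - alpha1)
    (hbeta : beta < 1) (halpha : alpha2 - alpha1 < 1)
    (ht1 : 0 < t1) (ht2 : 0 < t2) (hh : h1 < h2) (hl : l1 < l2)
    (hc1 : 0 < 1 + h2 - l2 - beta)
    (hc2 : 0 < 2 + 2 * h2 - l1 - l2 - beta) :
  poly_asymp N.+1 c
    (fun q : R =>
       ((t1 * t2) ^- N.+1 * q `^ ((N%:R / 2 + lam - h1 - h2) * (N%:R + 1))) *: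
       \prod_(1 <= k < N.+2) ('X + (q `^ (3 / 2 - k%:R + h1 - lam) * t1)%:P))
  /\
  (exists E : nat -> R -> R,
     (\forall q \near 0^'+,
        forall k : nat, (1 <= k <= N.+1)%N -> (c q).[E k q] = 0) /\
     (forall k : nat, (1 <= k <= N.+1)%N ->
        asymp (E k) (fun q : R => - (q `^ (- k%:R + 3 / 2 + h1 - lam) * t1)))).
Proof.
have cl := c_poly_close ht1 ht2 hbeta hN halpha hh hl hc1 hc2.
pose lead q :=
  \prod_(i < N.+1) leading_factor t1 t2 h1 h2 l1 l2 alpha1 alpha2 beta i q.
pose scale q :=
  \prod_(i < N.+1) leading_scale t1 t2 h1 h2 l1 l2 alpha1 alpha2 beta i q.
pose a i q := leading_root t1 h1 h2 l1 l2 alpha1 alpha2 beta i q.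
have leadE q : lead q = scale q *: \prod_(i < N.+1) ('X + (a i q)%:P).
  exact: scaler_prod.
have scale_gt0 q : 0 < q -> 0 < scale q.
  by move=> q0; apply: prodr_gt0 => i _; exact: leading_scale_gt0.
have a_gt0 i q : 0 < q -> 0 < a i q by move=> q0; exact: leading_root_gt0.
split.
  split=> [q /andP[q0 _]|j jN].
    split; first exact: size_c_poly.
    rewrite -prod_leading_factor// -/(lead q) leadE.
    apply: leq_trans (size_scale_leq _ _) _.
    exact/eq_leq/(size_XaddC_prod (a ^~ q)).
  apply: (@near_eq_asymp _ _ (fun q => (c q)`_j) _ (fun q => (lead q)`_j)) => //.
  - exact: nearW.
  - by apply: near0_gt0 => q /andP[q0 _]; rewrite -prod_leading_factor.
  apply: near_le_asymp.
    apply: near0_gt0 => q /andP[q0 _]; rewrite leadE coefZ mulr_gt0 ?scale_gt0//.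
    by apply: (@coef_prod_XaddC_gt0 _ (a ^~ q)) => // i; exact: a_gt0.
  by move=> e e0; near=> q; have := near (cl e e0) q; apply.
(* The predecessor matches the 0-based [a] with the index k >= 1.  The bound on
   k sits below the existential, so that choice applies to all k at once. *)
have roots k : exists f : R -> R, (k.-1 <= N)%N ->
    (\forall q \near 0^'+, (c q).[- (a k.-1 q * f q)] = 0) /\
    f q @[q --> 0^'+] --> (1 : R).
  have [kN|] := boolP (k.-1 <= N)%N; last by exists 0.
  have [d d01|f fP] := @select_cvg R (fun q x => (c q).[- (a k.-1 q * x)] = 0) 1.
    have d0 : 0 < d / 3 by case/andP: d01 => d0 _; rewrite divr_gt0.
    (* Half of the threshold in [root_near_scale]. *)
    have e0 : 0 < (d / 3) ^+ N.+1 / 2 by rewrite divr_gt0// exprn_gt0.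
    near=> q.
    have q0 : 0 < q by near: q; exact: nbhs_right_gt.
    have q6 : q < 1 / 6 by near: q; apply: nbhs_right_lt; rewrite divr_gt0.
    apply: (@root_near_scale R N.+1 k.-1 (a ^~ q) (scale q)
      ((d / 3) ^+ N.+1 / 2) d) => //.
    - exact: scale_gt0.
    - by move=> i _; exact: a_gt0.
    - move=> i j /andP[ij _].
      apply: (@geometric_sep _ (a ^~ q)) ij => m; first exact: a_gt0.
      have am := a_gt0 m.+1 q q0.
      by rewrite /a leading_rootS// -/(a m.+1 q); nra.
    - by rewrite ltr_pdivrMr// ltr_pMr ?exprn_gt0//; lra.
    - by rewrite -leadE; near: q; exact: cl.
  by exists f.
have [f fP] := choice roots.
exists (fun k q => - (a k.-1 q * f k q)); split.
  have : \forall q \near 0^'+, forall k, (k <= N.+1)%N ->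
      (c q).[- (a k.-1 q * f k q)] = 0.
    apply: near_forall_leq => k kN; have kN' : (k.-1 <= N)%N by case: k kN.
    by case: (fP k kN').
  by apply: filterS => q h k /andP[_]; exact: h.
move=> [//|k] kN; have [_] := fP k.+1 kN.
rewrite /asymp; apply: cvg_trans; apply: near_eq_cvg.
apply: near0_gt0 => q /andP[q0 _].
have -> : q `^ (- k.+1%:R + 3 / 2 + h1 - lam) * t1 = a k q.
  by rewrite /a /leading_root -(natr1 k) -/lam; congr (_ `^ _ * _); field.
by rewrite invrN mulrNN mulrC mulKf// gt_eqF// a_gt0.
Unshelve. all: by end_near. Qed.
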